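(* Let $\mathcal{B}^\star$ be the Hall set over $X=\{X_0,X_1\}$ defined in the context and, for $k\in\mathbb{N}^*$, let $\mathcal{B}^\star_k:=\{b\in\mathcal{B}^\star : n_1(b)=k\}$. With indices implicitly ranging over $j,k,l,m\in\mathbb{N}^*$ and $\mu,\nu\in\mathbb{N}$, define the following elements of $\mathrm{Br}(X)$: $$M_\nu:=X_1 0^\nu,\qquad W_{j,\nu}:=(M_{j-1},M_j)0^\nu,\qquad P_{j,k,\nu}:=(M_{k-1},W_{j,0})0^\nu,$$ $$Q_{j,k,l,\nu}:=(M_{l-1},P_{j,k,0})0^\nu,\qquad Q^\sharp_{j,\mu,k,\nu}:=(W_{j,\mu},W_{k,0})0^\nu,\qquad Q^\flat_{j,\mu,\nu}:=(W_{j,\mu},W_{j,\mu+1})0^\nu,$$ $$R_{j,k,l,m,\nu}:=(M_{m-1},Q_{j,k,l,0})0^\nu,\qquad R^\sharp_{j,k,l,\mu,\nu}:=(W_{l,\mu},P_{j,k,0})0^\nu.$$ Then $$\mathcal{B}^\star_1=\{M_\nu\},\qquad \mathcal{B}^\star_2=\{W_{j,\nu}\},\qquad \mathcal{B}^\star_3=\{P_{j,k,\nu}: j\le k\},$$ $$\mathcal{B}^\star_4=\{Q_{j,k,l,\nu}: j\le k\le l\}\cup\{Q^\sharp_{j,\mu,k,\nu}: j<k\}\cup\{Q^\flat_{j,\mu,\nu}\},$$ $$\mathcal{B}^\star_5=\{R_{j,k,l,m,\nu}: j\le k\le l\le m\}\cup\{R^\sharp_{j,k,l,\mu,\nu}: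 j\le k\}.$$
   Context: $\mathbb{N}=\{0,1,2,\dots\}$, $\mathbb{N}^*=\mathbb{N}\setminus\{0\}$. Brackets. Let $X=\{X_0,X_1\}$ be two non-commutative indeterminates. $\mathrm{Br}(X)$ is the free magma over $X$: $X_0,X_1\in\mathrm{Br}(X)$ and the ordered pair $(a,b)\in\mathrm{Br}(X)$ whenever $a,b\in\mathrm{Br}(X)$. For $b\in\mathrm{Br}(X)$, $n_0(b)$ and $n_1(b)$ are the numbers of occurrences of $X_0$ and $X_1$ in $b$. For $b=(b_1,b_2)$, set $\lambda(b)=b_1$, $\mu(b)=b_2$. For $\nu\in\mathbb{N}$, $b0^\nu:=(\cdots((b,X_0),X_0)\cdots,X_0)$ with $X_0$ appended $\nu$ times. Hall set. A Hall set is a subset $\mathcal{B}\subset\mathrm{Br}(X)$ totally ordered by a relation $<$ such that: (i) $X\subset\mathcal{B}$; (ii) for $b=(b_1,b_2)\in\mathrm{Br}(X)$, $b\in\mathcal{B}$ iff $b_1,b_2\in\mathcal{B}$, $b_1<b_2$ and either $b_2\in X$ or $\lambda(b_2)\le b_1$; (iii) for all $b_1,b_2\in\mathcal{B}$ with $(b_1,b_2)\in\mathcal{B}$, $b_1<(b_1,b_2)$. The Hall set $\mathcal{B}^\star$. Let $G\subset\mathrm{Br}(X)$ be the smallest subset with $X_0,X_1\in G$ and $(a,b)\in G$ whenever $a,b\in G$, $a\ne X_0$. Every $b\in G\setminus\{X_0\}$ is uniquely written $b=b^*0^{\nu_b}$ with $\nu_b\in\mathbb{N}$, $b^*\in G$,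 and either $b^*=X_1$ or $b^*=(b_1,b_2)$ with $b_1\ne X_0$, $b_2\neq X_0$; $b^*$ is called the germ of $b$, and $b$ is a germ when $b=b^*$. $G$ is endowed with the total order: (B0) $X_0$ is the maximal element; (B1) for $a,b\in G\setminus\{X_0\}$, $a<b$ iff $a^*<b^*$, or $a^*=b^*$ and $\nu_a<\nu_b$; (B2) for germs $a^*,b^*$, $a^*<b^*$ iff $n_1(a^* )<n_1(b^* )$, or $n_1(a^* )=n_1(b^* )$ and $\lambda(a^* )<\lambda(b^* )$, or $n_1(a^* )=n_1(b^* )$, $\lambda(a^* )=\lambda(b^* )$ and $\mu(a^* )<\mu(b^* )$. $\mathcal{B}^\star$ is the unique subset of $G$ which is a Hall set for (the restriction of) this order. *)

(* Defs.v *)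
From mathcomp Require Import all_boot boolp classical_sets.
From mathcomp Require Import zify.

Set Implicit Arguments.
Unset Strict Implicit.
Unset Printing Implicit Defensive.

Local Open Scope classical_set_scope.

(* The free magma over {X0, X1}; [brk a b] is the ordered pair (a, b). *)
Inductive Br : Type := X0 | X1 | brk (a b : Br).

Fixpoint n0 (b : Br) : nat :=
  match b with X0 => 1 | X1 => 0 | brk b1 b2 => n0 b1 + n0 b2 end.

Fixpoint n1 (b : Br) : nat :=
  match b with X0 => 0 | X1 => 1 | brk b1 b2 => n1 b1 + n1 b2 end.

(* Left and right factors. They are only meaningful on pairs; the values on
   X0 and X1 are junk and are never relevant below. *)
Definition lam (b : Br) : Br := if b is brk b1 _ then b1 else b.
Definition mu (b : Br) : Br := if b is brk _ b2 then b2 else b.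

(* b0^nu *)
Definition app0 (b : Br) (nu : nat) : Br := iter nu (fun c => brk c X0) b.

Definition strict_total_order_on (T : Type) (A : set T) (lt : T -> T -> Prop) :=
  [/\ forall a, A a -> ~ lt a a,
      forall a b c, A a -> A b -> A c -> lt a b -> lt b c -> lt a c
    & forall a b, A a -> A b -> [\/ lt a b, a = b | lt b a]].

Record hall_set (lt : Br -> Br -> Prop) (B : set Br) : Prop := HallSet {
  hall_order : strict_total_order_on B lt;
  hall_X : B X0 /\ B X1;
  hall_brk : forall b1 b2, B (brk b1 b2) <->
    [/\ B b1, B b2, lt b1 b2
      & (b2 = X0 \/ b2 = X1) \/ (lt (lam b2) b1 \/ lam b2 = b1)];
  hall_lt : forall b1 b2, B b1 -> B b2 -> B (brk b1 b2) -> lt b1 (brk b1 b2)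
}.

Inductive G : set Br :=
| G_X0 : G X0
| G_X1 : G X1
| G_brk a b : G a -> G b -> a <> X0 -> G (brk a b).

(* For b in G other than X0, [germ b] and [nu b] are the b^* and nu_b of the
   unique decomposition b = b^* 0^(nu_b); see [germ_unique]. *)
Fixpoint germ (b : Br) : Br := if b is brk b1 X0 then germ b1 else b.
Fixpoint nu (b : Br) : nat := if b is brk b1 X0 then (nu b1).+1 else 0.

Definition is_germ (b : Br) : Prop :=
  b = X1 \/ exists b1 b2, [/\ b = brk b1 b2, b1 <> X0 & b2 <> X0].

(* The least relation closed under (B0), (B1) and (B2). Only its restriction
   to G is meaningful; there it satisfies (B0), (B1) and (B2) as equivalences
   and is a strict total order: see [ltG_B0], [ltG_B1], [ltG_B2] and
   [ltG_total_order]. *)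
Inductive ltG : Br -> Br -> Prop :=
| ltG_X0 a : a <> X0 -> ltG a X0
| ltG_germ a b : a <> X0 -> b <> X0 -> ltG (germ a) (germ b) -> ltG a b
| ltG_nu a b : a <> X0 -> b <> X0 -> germ a = germ b -> nu a < nu b -> ltG a b
| ltG_n1 a b : is_germ a -> is_germ b -> n1 a < n1 b -> ltG a b
| ltG_lam a b : is_germ a -> is_germ b -> n1 a = n1 b ->
    ltG (lam a) (lam b) -> ltG a b
| ltG_mu a b : is_germ a -> is_germ b -> n1 a = n1 b -> lam a = lam b ->
    ltG (mu a) (mu b) -> ltG a b.

Lemma eq_X0 b : {b = X0} + {b <> X0}.
Proof. by case: b => [||a b]; [left|right|right]. Qed.

Lemma is_germ_nX0 b : is_germ b -> b <> X0.
Proof. by case=> [->//|[b1 [b2 [-> _ _]]]]. Qed.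

Lemma germK b : is_germ b -> germ b = b.
Proof. by case=> [->//|[b1 [[||c d] [-> _ h2]]]]. Qed.

Lemma nu_germ b : is_germ b -> nu b = 0.
Proof. by case=> [->//|[b1 [[||c d] [-> _ h2]]]]. Qed.

Lemma germP b : G b -> b <> X0 ->
  [/\ G (germ b), is_germ (germ b) & b = app0 (germ b) (nu b)].
Proof.
elim=> {b} [//| _ | a b Ga IHa Gb IHb na _].
  by split; [constructor|left|].
case: (eq_X0 b) => [->|nb] /=.
  by have [h1 h2 h3] := IHa na; split=> //=; rewrite {1}h3.
have -> : (if b is X0 then germ a else brk a b) = brk a b by case: b nb {Gb IHb}.
have -> : (if b is X0 then (nu a).+1 else 0) = 0 by case: b nb {Gb IHb}.
by split; [constructor|right; exists a, b|].
Qed.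

Lemma germ_unique b : G b -> b <> X0 ->
  exists! p : Br * nat, [/\ G p.1, is_germ p.1 & b = app0 p.1 p.2].
Proof.
move=> Gb nb; exists (germ b, nu b); split; first exact: germP.
case=> c n /= [Gc gc ->].
have [-> ->] : germ (app0 c n) = c /\ nu (app0 c n) = n; last by [].
elim: n => [|n [IH1 IH2]] /=; last by rewrite IH1 IH2.
by rewrite germK // nu_germ.
Qed.

Lemma G_n1 b : G b -> b <> X0 -> 0 < n1 b.
Proof. by elim=> // a c _ IH _ _ na _ /=; have := IH na; lia. Qed.

Lemma germ_case a b : G a -> G b -> is_germ a -> is_germ b -> n1 a = n1 b ->
  (a = X1 /\ b = X1) \/
  exists a1 a2 b1 b2, [/\ a = brk a1 a2, b = brk b1 b2, a2 <> X0 & b2 <> X0]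
    /\ [/\ G a1, G a2, G b1 & G b2].
Proof.
move=> Ga Gb ga gb; case: ga Ga => [->|[a1 [a2 [-> h1 h2]]]] Ga;
  case: gb Gb => [->|[b1 [b2 [-> h3 h4]]]] Gb; first by left.
- inversion Gb; subst => /= h.
  have := G_n1 H1 H3; have := G_n1 H2 h4; lia.
- inversion Ga; subst => /= h.
  have := G_n1 H1 H3; have := G_n1 H2 h2; lia.
- by inversion Ga; inversion Gb; subst; right; exists a1, a2, b1, b2.
Qed.

Lemma G_lam b : G b -> G (lam b).
Proof. by case=> //; constructor. Qed.

Lemma G_mu b : G b -> G (mu b).
Proof. by case=> //; constructor. Qed.

Lemma ltG_neq a b : ltG a b -> G a -> G b -> a <> b.
Proof.
elim=> {a b} [//|a b na nb _ IH Ga Gb ab|a b _ _ _ h _ _ ab|a b _ _ h _ _ ab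
  |a b _ _ _ _ IH Ga Gb ab|a b _ _ _ _ _ IH Ga Gb ab].
- have [ha _ _] := germP Ga na; have [hb _ _] := germP Gb nb.
  by apply: (IH ha hb); rewrite ab.
- by rewrite ab ltnn in h.
- by rewrite ab ltnn in h.
- by apply: (IH (G_lam Ga) (G_lam Gb)); rewrite ab.
- by apply: (IH (G_mu Ga) (G_mu Gb)); rewrite ab.
Qed.

Lemma ltG_nX0 b : G b -> ~ ltG X0 b.
Proof.
move=> Gb h; have nb : b <> X0 by move=> e; apply: (ltG_neq h); rewrite ?e; constructor.
inversion h; subst => //; try by [apply: nb|apply: H];
  by move: (is_germ_nX0 H).
Qed.

Lemma ltG_B0 a : G a -> a <> X0 -> ltG a X0 /\ ~ ltG X0 a.
Proof. by move=> Ga na; split; [constructor|exact: ltG_nX0]. Qed.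

Lemma ltG_B1 a b : G a -> G b -> a <> X0 -> b <> X0 ->
  ltG a b <-> ltG (germ a) (germ b) \/ (germ a = germ b /\ nu a < nu b).
Proof.
move=> Ga Gb na nb; split=> [h|[h|[h h']]].
- case: h (h) na nb {Ga Gb} => {a b} //.
  + by move=> a b _ _ h _ _ _; left.
  + by move=> a b _ _ h h' _ _ _; right.
  + by move=> a b ga gb _ h _ _; left; rewrite !germK.
  + by move=> a b ga gb _ _ h _ _; left; rewrite !germK.
  + by move=> a b ga gb _ _ _ h _ _; left; rewrite !germK.
- exact: ltG_germ.
- exact: ltG_nu.
Qed.

Lemma ltG_B2 a b : G a -> G b -> is_germ a -> is_germ b ->
  ltG a b <-> [\/ n1 a < n1 b, n1 a = n1 b /\ ltG (lam a) (lam b)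
    | [/\ n1 a = n1 b, lam a = lam b & ltG (mu a) (mu b)]].
Proof.
move=> Ga Gb ga gb; split=> [h|[h|[h h']|[h h' h'']]].
- elim: h Ga Gb ga gb => {a b}.
  + by move=> a _ _ _ _ /is_germ_nX0.
  + by move=> a b _ _ _ IH Ga Gb ga gb; move: IH; rewrite !germK //; exact.
  + by move=> a b _ _ _ h _ _ ga gb; rewrite !nu_germ in h.
  + by move=> a b _ _ h _ _ _ _; constructor 1.
  + by move=> a b _ _ h h' _ _ _ _ _; constructor 2.
  + by move=> a b _ _ h h' h'' _ _ _ _ _; constructor 3.
- exact: ltG_n1.
- exact: ltG_lam.
- exact: ltG_mu.
Qed.

Lemma len_gt0 b : 0 < n0 b + n1 b.
Proof. by elim: b => //= a ha b hb; lia. Qed.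

Lemma len_germ b : n0 (germ b) + n1 (germ b) <= n0 b + n1 b.
Proof. by elim: b => //= a ha [||c d] hb //=; lia. Qed.

(* Totality and transitivity reduce to germs by (B1), and are then proved by
   induction on the total length of the brackets. *)
Lemma ltG_total a b : G a -> G b -> [\/ ltG a b, a = b | ltG b a].
Proof.
have [n] := ubnP (n0 a + n1 a + (n0 b + n1 b)).
elim: n a b => // n IHn.
have Hg a b : n0 a + n1 a + (n0 b + n1 b) < n.+1 -> G a -> G b ->
    is_germ a -> is_germ b -> [\/ ltG a b, a = b | ltG b a].
  move=> hn Ga Gb ga gb; have [h|h|e] := ltngtP (n1 a) (n1 b).
  - by constructor 1; exact: ltG_n1.
  - by constructor 3; exact: ltG_n1.
  have [[-> ->]|] := germ_case Ga Gb ga gb e; first by constructor 2.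
  move=> [a1 [a2 [b1 [b2 [[ea eb na nb] [Ga1 Ga2 Gb1 Gb2]]]]]].
  have h1 : n0 a1 + n1 a1 + (n0 b1 + n1 b1) < n.
    by move: hn; rewrite ea eb /=; have := len_gt0 a2; lia.
  have h2 : n0 a2 + n1 a2 + (n0 b2 + n1 b2) < n.
    by move: hn; rewrite ea eb /=; have := len_gt0 a1; lia.
  case: (IHn _ _ h1 Ga1 Gb1) => [h|h|h].
  - by constructor 1; apply: ltG_lam; rewrite // ea eb.
  - case: (IHn _ _ h2 Ga2 Gb2) => [h'|h'|h'].
    + by constructor 1; apply: ltG_mu; rewrite // ea eb.
    + by constructor 2; rewrite ea eb h h'.
    + by constructor 3; apply: ltG_mu; rewrite // ea eb.
  - by constructor 3; apply: ltG_lam; rewrite // ea eb.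
move=> a b hn Ga Gb.
case: (eq_X0 a) => [->|na]; case: (eq_X0 b) => [->|nb].
- by constructor 2.
- by constructor 3; constructor.
- by constructor 1; constructor.
have [Gga ga ea] := germP Ga na; have [Ggb gb eb] := germP Gb nb.
have hl : n0 (germ a) + n1 (germ a) + (n0 (germ b) + n1 (germ b)) < n.+1.
  by have := len_germ a; have := len_germ b; lia.
case: (Hg _ _ hl Gga Ggb ga gb) => [h|h|h].
- by constructor 1; exact: ltG_germ.
- have [h'|h'|h'] := ltngtP (nu a) (nu b).
  + by constructor 1; exact: ltG_nu.
  + by constructor 3; apply: ltG_nu.
  + by constructor 2; rewrite ea eb h h'.
- by constructor 3; exact: ltG_germ.
Qed.

Lemma ltG_trans a b c : G a -> G b -> G c -> ltG a b -> ltG b c -> ltG a c.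
Proof.
have [n] := ubnP (n0 a + n1 a + (n0 b + n1 b) + (n0 c + n1 c)).
elim: n a b c => // n IHn.
have Hg a b c : n0 a + n1 a + (n0 b + n1 b) + (n0 c + n1 c) < n.+1 ->
    G a -> G b -> G c -> is_germ a -> is_germ b -> is_germ c ->
    ltG a b -> ltG b c -> ltG a c.
  move=> hn Ga Gb Gc ga gb gc hab hbc.
  have := hab => /(ltG_B2 Ga Gb ga gb) => hab'.
  have := hbc => /(ltG_B2 Gb Gc gb gc) => hbc'.
  have [h|h|e] := ltngtP (n1 a) (n1 c); first exact: ltG_n1.
    by exfalso; case: hab' => [?|[? _]|[? _ _]]; case: hbc' => [?|[? _]|[? _ _]]; lia.
  have eab : n1 a = n1 b.
    by case: hab' => [?|[? _]|[? _ _]]; case: hbc' => [?|[? _]|[? _ _]]; lia.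
  have ebc : n1 b = n1 c by rewrite -eab.
  have [[ea eb]|] := germ_case Ga Gb ga gb eab.
    by exfalso; apply: (ltG_neq hab) => //; rewrite ea eb.
  move=> [a1 [a2 [b1 [b2 [[ea eb na nb] [Ga1 Ga2 Gb1 Gb2]]]]]].
  have [[eb' ec]|] := germ_case Gb Gc gb gc ebc.
    by rewrite eb in eb'.
  move=> [d1 [d2 [c1 [c2 [[ed ec nd nc] [_ _ Gc1 Gc2]]]]]] {d1 d2 ed nd}.
  have h1 : n0 a1 + n1 a1 + (n0 b1 + n1 b1) + (n0 c1 + n1 c1) < n.
    by move: hn; rewrite ea eb ec /=; have := len_gt0 a2; lia.
  have h2 : n0 a2 + n1 a2 + (n0 b2 + n1 b2) + (n0 c2 + n1 c2) < n.
    by move: hn; rewrite ea eb ec /=; have := len_gt0 a1; lia.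
  rewrite ea eb /= in hab'; rewrite eb ec /= in hbc'.
  rewrite ea eb /= in eab; rewrite eb ec /= in ebc.
  rewrite eab ltnn in hab'; rewrite ebc ltnn in hbc'.
  case: hab' => [//|[_ l1]|[_ l1 m1]]; case: hbc' => [//|[_ l2]|[_ l2 m2]].
  - by apply: ltG_lam; rewrite // ea ec /=; exact: IHn h1 Ga1 Gb1 Gc1 l1 l2.
  - by apply: ltG_lam; rewrite // ea ec /= -l2.
  - by apply: ltG_lam; rewrite // ea ec /= l1.
  - by apply: ltG_mu; rewrite // ea ec /= ?l1 //; exact: IHn h2 Ga2 Gb2 Gc2 m1 m2.
move=> a b c hn Ga Gb Gc hab hbc.
have na : a <> X0 by move=> e; rewrite e in hab; exact: ltG_nX0 Gb hab.
have nb : b <> X0 by move=> e; rewrite e in hbc; exact: ltG_nX0 Gc hbc.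
case: (eq_X0 c) => [->|nc]; first by constructor.
have [Gga ga _] := germP Ga na; have [Ggb gb _] := germP Gb nb.
have [Ggc gc _] := germP Gc nc.
have hl : n0 (germ a) + n1 (germ a) + (n0 (germ b) + n1 (germ b))
    + (n0 (germ c) + n1 (germ c)) < n.+1.
  by have := len_germ a; have := len_germ b; have := len_germ c; lia.
move: hab => /(ltG_B1 Ga Gb na nb) hab; move: hbc => /(ltG_B1 Gb Gc nb nc) hbc.
apply/(ltG_B1 Ga Gc na nc).
case: hab => [l1|[l1 m1]]; case: hbc => [l2|[l2 m2]].
- by left; exact: Hg hl Gga Ggb Ggc ga gb gc l1 l2.
- by left; rewrite -l2.
- by left; rewrite l1.
- by right; split; [rewrite l1|exact: ltn_trans m1 m2].
Qed.

Lemma ltG_total_order : strict_total_order_on G ltG.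
Proof.
split; first by move=> a Ga h; exact: (ltG_neq h Ga Ga erefl).
  exact: ltG_trans.
exact: ltG_total.
Qed.

Lemma Bstar_exists_unique : exists! B : set Br, B `<=` G /\ hall_set ltG B.
Proof.
pose cond b1 b2 := ltG b1 b2 /\
  ((b2 = X0 \/ b2 = X1) \/ (ltG (lam b2) b1 \/ lam b2 = b1)).
pose B := fix B b := if b is brk b1 b2 then [/\ B b1, B b2 & cond b1 b2] else True.
have BG : B `<=` G.
  elim=> [||a IHa b IHb] /=; [by constructor|by constructor|].
  move=> [/IHa Ga /IHb Gb [h _]]; constructor => //.
  by move=> e; rewrite e in h; exact: ltG_nX0 Gb h.
exists B; split.
  split=> //; split.
  - have [h1 h2 h3] := ltG_total_order; split.
    + by move=> a /BG; exact: h1.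
    + by move=> a b c /BG Ga /BG Gb /BG Gc; exact: h2.
    + by move=> a b /BG Ga /BG Gb; exact: h3.
  - by [].
  - by move=> b1 b2 /=; split=> [[? ? []]|[]].
  - move=> b1 b2 /BG Gb1 /BG Gb2 /BG Gb.
    have nb1 : b1 <> X0 by inversion Gb.
    case: (eq_X0 b2) => [e|nb2]; first by rewrite e; apply: ltG_nu.
    have gb : is_germ (brk b1 b2) by right; exists b1, b2.
    have [Gg gg _] := germP Gb1 nb1.
    apply: ltG_germ => //; rewrite (germK gb); apply: ltG_n1 => //=.
    have := G_n1 Gb2 nb2; suff -> : n1 (germ b1) = n1 b1 by lia.
    by elim: {+}b1 => //= a IHa [||c d] _ //=; rewrite IHa addn0.
move=> B' [_ [_ [h0 h1] hb _]]; apply/seteqP; split.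
  elim=> [||a IHa b IHb] // [/IHa Ba /IHb Bb [h h']]; exact/hb.
by elim=> [||a IHa b IHb] // /hb [/IHa Ba /IHb Bb h h'].
Qed.

Definition Bstar : set Br := sval (cid Bstar_exists_unique).

Lemma Bstar_spec : Bstar `<=` G /\ hall_set ltG Bstar.
Proof. by rewrite /Bstar; case: cid => B []. Qed.

Definition Bstar_k (k : nat) : set Br := [set b | Bstar b /\ n1 b = k].

(* The indices j, k, l, m below range over positive integers, so that the
   truncated predecessors are genuine. *)
Definition M nu := app0 X1 nu.
Definition W j nu := app0 (brk (M j.-1) (M j)) nu.
Definition P j k nu := app0 (brk (M k.-1) (W j 0)) nu.
Definition Q j k l nu := app0 (brk (M l.-1) (P j k 0)) nu.
Definition Qsharp j mu k nu := app0 (brk (W j mu) (W k 0)) nu.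
Definition Qflat j mu nu := app0 (brk (W j mu) (W j mu.+1)) nu.
Definition R j k l m nu := app0 (brk (M m.-1) (Q j k l 0)) nu.
Definition Rsharp j k l mu nu := app0 (brk (W l mu) (P j k 0)) nu.

(* Main.v *)
Require Import Defs.
From mathcomp Require Import all_boot boolp classical_sets.
From mathcomp Require Import zify.
Local Open Scope classical_set_scope.

(** Being maximal, X0 can be appended to every element b of the Hall set other
    than X0: b < X0 always holds, and a right factor in X carries no further
    constraint. So the layer of degree k in X1 is known once its germs are,
    and the work is to list the germs of degree at most five.

    Let (b1, b2) be a germ in the Hall set, with b2 = h0^m for a germ h. If
    m > 0 then lam b2 = h0^(m-1), so the Hall conditions read
    h0^(m-1) <= b1 < h0^m, and since b1 is compared with these brackets by its
    germ and then by its exponent, b1 = h0^(m-1). If m = 0 then b2 = h is a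
    germ, different from X1 because X1 is minimal, and it remains that
    lam h <= b1 < h. Hence a germ of degree k > 1 is of one of two kinds
    (BgermP):
    - (h0^n, h0^(n+1)) for a germ h of degree k / 2, so k is even;
    - (f0^n, h) for germs f < h of degrees p and q, with p + q = k, q > 1 and
      lam h <= f0^n.
    As the order refines the degree, p <= q, and the condition f < h is
    automatic when p < q; likewise lam h <= f0^n is automatic when lam h has
    smaller degree than f and impossible when it has larger degree. What is
    left is a comparison of exponents of the M's, or of the indices of two
    W's when p = q = 2, and the germs of degree 2, 3, 4 and 5 follow
    successively. For instance the pairs (M_i, Qsharp) and (M_i, Qflat) are
    excluded in degree 5 because the left factor of the second component has
    degree 2. *)

(** * The order on the brackets of G *)

Definition leG (a b : Br) : Prop := ltG a b \/ a = b.

Lemma Bstar_G {b} : Bstar b -> G b.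
Proof. exact: (proj1 Bstar_spec). Qed.

Lemma Bstar_hall : hall_set ltG Bstar.
Proof. exact: (proj2 Bstar_spec). Qed.

Lemma ltG_irr {a} : G a -> ~ ltG a a.
Proof. by move=> Ga h; exact: (ltG_neq h Ga Ga). Qed.

Lemma ltG_asym {a b} : G a -> G b -> ltG a b -> ~ ltG b a.
Proof. by move=> Ga Gb h h'; exact: (ltG_irr Ga (ltG_trans Ga Gb Ga h h')). Qed.

Lemma app0_nX0 g n : g <> X0 -> app0 g n <> X0.
Proof. by case: n. Qed.

Lemma G_app0 g n : G g -> g <> X0 -> G (app0 g n).
Proof.
move=> Gg ng; elim: n => //= n IH; constructor=> //; first by constructor.
exact: app0_nX0.
Qed.

Lemma n1_app0 g n : n1 (app0 g n) = n1 g.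
Proof. by elim: n => //= n ->; rewrite addn0. Qed.

Lemma germ_app0 g n : is_germ g -> germ (app0 g n) = g.
Proof. by move=> gg; elim: n => //=; exact: germK. Qed.

Lemma nu_app0 g n : is_germ g -> nu (app0 g n) = n.
Proof. by move=> gg; elim: n => [|n /= ->] //; exact: nu_germ. Qed.

Lemma app0_inj g h m n : is_germ g -> is_germ h ->
  app0 g m = app0 h n -> g = h /\ m = n.
Proof.
move=> gg gh e; split; first by rewrite -(germ_app0 _ m gg) e germ_app0.
by rewrite -(nu_app0 _ m gg) e nu_app0.
Qed.

Lemma ltG_app0 g h m n : G g -> G h -> is_germ g -> is_germ h ->
  ltG (app0 g m) (app0 h n) <-> ltG g h \/ (g = h /\ m < n).
Proof.
move=> Gg Gh gg gh; have ng := is_germ_nX0 gg; have nh := is_germ_nX0 gh.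
have := ltG_B1 (G_app0 g m Gg ng) (G_app0 h n Gh nh) (app0_nX0 g m ng)
  (app0_nX0 h n nh).
by rewrite !germ_app0 // !nu_app0.
Qed.

Lemma leG_app0 g h m n : G g -> G h -> is_germ g -> is_germ h ->
  leG (app0 g m) (app0 h n) <-> ltG g h \/ (g = h /\ m <= n).
Proof.
move=> Gg Gh gg gh; rewrite /leG ltG_app0 //; split.
  case=> [[?|[? lt]]|/(app0_inj _ _ _ _ gg gh)[e ->]].
  - by left.
  - by right; split=> //; exact: ltnW.
  - by right.
case=> [?|[e]]; first by left; left.
rewrite leq_eqVlt => /orP[/eqP->|?]; first by right; rewrite e.
by left; right.
Qed.

Lemma ltG_germ_n1 g h : G g -> G h -> is_germ g -> is_germ h -> ltG g h ->
  n1 g <= n1 h.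
Proof.
move=> Gg Gh gg gh /(ltG_B2 Gg Gh gg gh)[/ltnW|[->]|[->]] //.
Qed.

Lemma germ_n1_eq1 g : G g -> is_germ g -> n1 g = 1 -> g = X1.
Proof.
move=> Gg gg eg.
by have [[]|[? [? [? [? [[]]]]]]] := germ_case Gg G_X1 gg (or_introl erefl) eg.
Qed.

(** The minimality of X1 rules it out as a right factor. *)
Lemma ltG_nX1 b : G b -> ~ ltG b X1.
Proof.
move=> Gb lt; have GX1 := G_X1; have gX1 : is_germ X1 by left.
have nb : b <> X0 by move=> e; rewrite e in lt; exact: ltG_nX0 GX1 lt.
have [Gg gg eb] := germP Gb nb.
move: lt; rewrite eb => /(ltG_app0 _ X1 _ 0 Gg GX1 gg gX1)[lt|[_]] //.
have := G_n1 Gg (is_germ_nX0 gg) => gt0.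
have := ltG_germ_n1 _ _ Gg GX1 gg gX1 lt => /= le1.
have e : germ b = X1 by apply: germ_n1_eq1 => //; lia.
by rewrite e in lt; exact: ltG_irr lt.
Qed.

(** * Germs of the Hall set *)

Lemma Bstar_brk b1 b2 : Bstar (brk b1 b2) <->
  [/\ Bstar b1, Bstar b2, ltG b1 b2
    & (b2 = X0 \/ b2 = X1) \/ leG (lam b2) b1].
Proof. exact: (hall_brk Bstar_hall b1 b2). Qed.

Lemma Bstar_app0 g n : g <> X0 -> Bstar (app0 g n) <-> Bstar g.
Proof.
move=> ng; elim: n => //= n IH; rewrite Bstar_brk -IH; split=> [[]|B] //.
split=> //; [exact: (proj1 (hall_X Bstar_hall))| |by left; left].
by constructor; exact: app0_nX0.
Qed.

Definition Bgerm (k : nat) : set Br :=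
  [set g | [/\ Bstar g, is_germ g & n1 g = k]].

Lemma Bstar_germP {b} : Bstar b -> b <> X0 ->
  Bgerm (n1 b) (germ b) /\ b = app0 (germ b) (nu b).
Proof.
move=> Bb nb; have [Gg gg eb] := germP (Bstar_G Bb) nb; split=> //; split=> //.
  by apply/(Bstar_app0 _ (nu b) (is_germ_nX0 gg)); rewrite -eb.
by rewrite [in RHS]eb n1_app0.
Qed.

(** X0 is always admissible as a right factor, since it is maximal; hence
    each layer is determined by its germs. *)
Lemma Bstar_kE k : 0 < k ->
  Bstar_k k = [set b | exists g nu, Bgerm k g /\ b = app0 g nu].
Proof.
move=> k0; apply/seteqP; split=> b /=.
  move=> [Bb ek]; have nb : b <> X0 by move=> e; move: k0; rewrite -ek e.
  have [Bg eb] := Bstar_germP Bb nb.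
  by exists (germ b), (nu b); rewrite -ek.
move=> [g [n [[Bg gg eg] ->]]]; split; last by rewrite n1_app0.
by apply/Bstar_app0 => //; exact: is_germ_nX0.
Qed.

Lemma Bgerm_gt0 {k g} : Bgerm k g -> 0 < k.
Proof. by move=> [Bg gg <-]; apply: G_n1; [exact: Bstar_G|exact: is_germ_nX0]. Qed.

Lemma Bgerm_n1 {k g} : Bgerm k g -> n1 g = k.
Proof. by case. Qed.

(** If (b1, h0^(n+1)) is in the Hall set then h0^n <= b1 < h0^(n+1), and the
    order (B1) leaves only b1 = h0^n in that interval: this is the first case.
    Otherwise the right factor is itself a germ, and not X1 by minimality. *)
Lemma BgermP k g : 1 < k -> Bgerm k g <->
  (exists l h n, [/\ Bgerm l h, k = l + l & g = brk (app0 h n) (app0 h n.+1)])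
  \/ (exists p q f n h, [/\ Bgerm p f, Bgerm q h, 1 < q & k = p + q] /\
       [/\ ltG f h, leG (lam h) (app0 f n) & g = brk (app0 f n) h]).
Proof.
move=> k1; split.
  move=> [Bg [e|[b1 [b2 [e nb1 nb2]]]] ek]; first by rewrite -ek e in k1.
  move: Bg; rewrite e => /Bstar_brk[B1 B2 lt le].
  have {}le : leG (lam b2) b1.
    case: le => // -[//|e2]; rewrite e2 in lt.
    by have := ltG_nX1 _ (Bstar_G B1) lt.
  have [Bf e1] := Bstar_germP B1 nb1; have [Bh e2] := Bstar_germP B2 nb2.
  have ek' : k = n1 b1 + n1 b2 by rewrite -ek e.
  move: (Bf) (Bh) => [/Bstar_G Gf gf _] [/Bstar_G Gh gh _].
  move: Bf Bh e1 e2 Gf Gh gf gh ek'.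
  move: (germ b1) (nu b1) (germ b2) (n1 b1) (n1 b2) => f n h p q.
  case: (nu b2) => [|m] Bf Bh e1 e2 Gf Gh gf gh ek'.
    right; exists p, q, f, n, h; rewrite /= in e2; subst b2 b1.
    have lfh : ltG f h.
      by move: lt => /(ltG_app0 _ _ _ 0 Gf Gh gf gh)[|[]].
    have q1 : 1 < q.
      have := Bgerm_gt0 Bf; have := ltG_germ_n1 _ _ Gf Gh gf gh lfh.
      rewrite (Bgerm_n1 Bf) (Bgerm_n1 Bh); case: (ltnP 1 q) => // q1 pq p0.
      have eh : h = X1.
        by apply: germ_n1_eq1 => //; rewrite (Bgerm_n1 Bh); lia.
      by case: (ltG_nX1 _ Gf); rewrite -eh.
    by do 2!split.
  left; exists p, f, n; subst b1 b2.
  move: lt le => /(ltG_app0 _ _ _ _ Gf Gh gf gh) lt /=.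
  move=> /(leG_app0 _ _ _ _ Gh Gf gh gf) le.
  have [ehf em] : h = f /\ m = n.
    case: le lt => [l|[e' mn]] [l'|[e'' nm]]; subst.
    - by case: (ltG_asym Gf Gh l' l).
    - by case: (ltG_irr Gf l).
    - by case: (ltG_irr Gf l').
    - by split=> //; lia.
  subst h m; split=> //.
  by rewrite ek' -(Bgerm_n1 Bf) -(Bgerm_n1 Bh).
case=> [[l [h [n [[Bh gh eh] -> ->]]]]|].
  have nh := is_germ_nX0 gh; have Gh := Bstar_G Bh; split.
  - apply/Bstar_brk; split; try exact/Bstar_app0.
      by apply/ltG_app0 => //; right.
    by right; right.
  - by right; exists (app0 h n), (app0 h n.+1); split=> //; exact: app0_nX0.
  - by rewrite /= n1_app0 addn0 eh.
move=> [p [q [f [n [h [[[Bf gf ef] [Bh gh eh] q1 ->] [lt le ->]]]]]]].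
have nf := is_germ_nX0 gf; split.
- apply/Bstar_brk; split=> //; [exact/Bstar_app0| |by right].
  by apply/(ltG_app0 _ _ _ 0 (Bstar_G Bf) (Bstar_G Bh)) => //; left.
- right; exists (app0 f n), h; split=> //; first exact: app0_nX0.
  exact: is_germ_nX0.
- by rewrite /= n1_app0 ef eh.
Qed.

Lemma Bgerm_ltG {p q f h} : Bgerm p f -> Bgerm q h -> p < q -> ltG f h.
Proof. by move=> [_ gf <-] [_ gh <-]; exact: ltG_n1. Qed.

Lemma Bgerm_ltG_le {p q f h} : Bgerm p f -> Bgerm q h -> ltG f h -> p <= q.
Proof.
move=> [/Bstar_G Gf gf <-] [/Bstar_G Gh gh <-]; exact: ltG_germ_n1.
Qed.

Lemma Bgerm_leG {p q f h m n} : Bgerm p f -> Bgerm q h ->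
  leG (app0 f m) (app0 h n) <-> ltG f h \/ (f = h /\ m <= n).
Proof.
move=> [/Bstar_G Gf gf _] [/Bstar_G Gh gh _]; exact: leG_app0.
Qed.

Lemma Bgerm_leG_lt {p q f h m n} : Bgerm p f -> Bgerm q h -> p < q ->
  leG (app0 f m) (app0 h n).
Proof. by move=> Bf Bh pq; apply/(Bgerm_leG Bf Bh); left; exact: Bgerm_ltG Bf Bh pq. Qed.

Lemma Bgerm_leG_le {p q f h m n} : Bgerm p f -> Bgerm q h ->
  leG (app0 f m) (app0 h n) -> p <= q.
Proof.
move=> Bf Bh /(Bgerm_leG Bf Bh)[/(Bgerm_ltG_le Bf Bh)//|[e _]].
by rewrite -(Bgerm_n1 Bf) -(Bgerm_n1 Bh) e.
Qed.

(** * Enumeration of the germs of degree at most five *)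

Lemma Bgerm_X1 : Bgerm 1 X1.
Proof. by split; [exact: (proj2 (hall_X Bstar_hall))|left|]. Qed.

Lemma Bgerm1P g : Bgerm 1 g <-> g = X1.
Proof.
split=> [[Bg gg eg]|->]; last exact: Bgerm_X1.
exact: germ_n1_eq1 (Bstar_G Bg) gg eg.
Qed.

Lemma leG_M i j : leG (M i) (M j) <-> i <= j.
Proof.
rewrite (Bgerm_leG Bgerm_X1 Bgerm_X1); split=> [[/(ltG_irr G_X1)|[]]|] //.
by right.
Qed.

Lemma ltG_M i j : ltG (M i) (M j) <-> i < j.
Proof.
have gX1 : is_germ X1 by left.
rewrite (ltG_app0 _ _ _ _ G_X1 G_X1 gX1 gX1).
by split=> [[/(ltG_irr G_X1)|[]]|] //; right.
Qed.

Lemma Bgerm2P g : Bgerm 2 g <-> exists j, 0 < j /\ g = W j 0.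
Proof.
rewrite BgermP //; split.
  case=> [[l [h [n [Bh el ->]]]]|].
    have {}el : l = 1 by lia.
    by move: Bh; rewrite el => /Bgerm1P ->; exists n.+1.
  move=> [p [q [f [n [h [[Bf _ q1 e] _]]]]]].
  by have := Bgerm_gt0 Bf; lia.
move=> [j [j0 ->]]; left; exists 1, X1, j.-1; split=> //; first exact: Bgerm_X1.
by rewrite prednK.
Qed.

Lemma Bgerm_W {j} : 0 < j -> Bgerm 2 (W j 0).
Proof. by move=> j0; apply/Bgerm2P; exists j. Qed.

Lemma ltG_W j k : 0 < j -> 0 < k -> ltG (W j 0) (W k 0) <-> j < k.
Proof.
move=> j0 k0; have [/Bstar_G Gj gj nj] := Bgerm_W j0.
have [/Bstar_G Gk gk nk] := Bgerm_W k0.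
rewrite (ltG_B2 Gj Gk gj gk) nj nk /=; split.
  by case=> [//|[_ /ltG_M]|[_ _ /ltG_M]] //; lia.
by move=> jk; constructor 2; split=> //; apply/ltG_M; lia.
Qed.

Lemma Bgerm3P g : Bgerm 3 g <->
  exists j k, [/\ 0 < j, 0 < k, j <= k & g = P j k 0].
Proof.
rewrite BgermP //; split.
  case=> [[l [h [n [_ ? _]]]]|]; first lia.
  move=> [p [q [f [n [h [[Bf Bh q1 e] [_ le ->]]]]]]].
  have p0 := Bgerm_gt0 Bf; have [ep eq] : p = 1 /\ q = 2 by lia.
  subst p q; move: Bf Bh le => /Bgerm1P -> /Bgerm2P[j [j0 ->]] /=.
  by move=> /leG_M le; exists j, n.+1; split=> //; lia.
move=> [j [k [j0 k0 jk ->]]]; right; exists 1, 2, X1, k.-1, (W j 0).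
have BW := Bgerm_W j0; split; split=> //; [exact: Bgerm_X1| |].
  exact: Bgerm_ltG Bgerm_X1 BW _.
by apply/leG_M; lia.
Qed.

Lemma Bgerm_P {j k} : 0 < j -> j <= k -> Bgerm 3 (P j k 0).
Proof. by move=> j0 jk; apply/Bgerm3P; exists j, k; split=> //; lia. Qed.

Lemma Bgerm4P g : Bgerm 4 g <->
  [\/ exists j k l, [/\ 0 < j, j <= k, k <= l & g = Q j k l 0],
      exists j mu k, [/\ 0 < j, j < k & g = Qsharp j mu k 0]
    | exists j mu, 0 < j /\ g = Qflat j mu 0].
Proof.
rewrite BgermP //; split.
  case=> [[l [h [n [Bh el ->]]]]|].
    have {}el : l = 2 by lia.
    move: Bh; rewrite el => /Bgerm2P[j [j0 ->]].
    by constructor 3; exists j, n.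
  move=> [p [q [f [n [h [[Bf Bh q1 e] [lt le ->]]]]]]].
  have p0 := Bgerm_gt0 Bf.
  have [[ep eq]|[ep eq]] : p = 1 /\ q = 3 \/ p = 2 /\ q = 2 by lia.
    subst p q; move: Bf Bh le => /Bgerm1P -> /Bgerm3P[j [k [j0 k0 jk ->]]] /=.
    by move=> /leG_M le; constructor 1; exists j, k, n.+1; split=> //; lia.
  subst p q; move: Bf Bh lt => /Bgerm2P[j [j0 ->]] /Bgerm2P[k [k0 ->]].
  by move=> /ltG_W lt; constructor 2; exists j, n, k; split=> //; exact: lt.
case=> [[j [k [l [j0 jk kl ->]]]]|[j [m [k [j0 jk ->]]]]|[j [m [j0 ->]]]].
- right; exists 1, 3, X1, l.-1, (P j k 0); have BP := Bgerm_P j0 jk.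
  split; split=> //; [exact: Bgerm_X1|exact: Bgerm_ltG Bgerm_X1 BP _|].
  by apply/leG_M; lia.
- right; exists 2, 2, (W j 0), m, (W k 0); have k0 : 0 < k by lia.
  have BW := Bgerm_W j0; split; split=> //; [exact: Bgerm_W|exact/ltG_W|].
  exact: Bgerm_leG_lt Bgerm_X1 BW _.
- by left; exists 2, (W j 0), m; split=> //; exact: Bgerm_W.
Qed.

Lemma Bgerm_Q {j k l} : 0 < j -> j <= k -> k <= l -> Bgerm 4 (Q j k l 0).
Proof. by move=> *; apply/Bgerm4P; constructor 1; exists j, k, l. Qed.

Lemma leG_WM j m i : 0 < j -> ~ leG (W j m) (M i).
Proof. by move=> j0 /(Bgerm_leG_le (Bgerm_W j0) Bgerm_X1). Qed.

Lemma Bgerm5P g : Bgerm 5 g <->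
  (exists j k l m, [/\ 0 < j, j <= k, k <= l, l <= m & g = R j k l m 0]) \/
  (exists j k l mu, [/\ 0 < j, 0 < l, j <= k & g = Rsharp j k l mu 0]).
Proof.
rewrite BgermP //; split.
  case=> [[l [h [n [_ ? _]]]]|]; first lia.
  move=> [p [q [f [n [h [[Bf Bh q1 e] [lt le ->]]]]]]].
  have p0 := Bgerm_gt0 Bf; have pq := Bgerm_ltG_le Bf Bh lt.
  have [[ep eq]|[ep eq]] : p = 1 /\ q = 4 \/ p = 2 /\ q = 3 by lia.
    subst p q; move: Bf le => /Bgerm1P -> le.
    case/Bgerm4P: Bh le => [[j [k [l [j0 jk kl ->]]]]|[j [m [k [j0 jk ->]]]]
      |[j [m [j0 ->]]]] /=; try by move/leG_WM.
    by move=> /leG_M le; left; exists j, k, l, n.+1; split=> //; lia.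
  subst p q; move: Bf Bh => /Bgerm2P[l [l0 ->]] /Bgerm3P[j [k [j0 k0 jk ->]]].
  by right; exists j, k, l, n.
case=> [[j [k [l [m [j0 jk kl lm ->]]]]]|[j [k [l [m [j0 l0 jk ->]]]]]].
- right; exists 1, 4, X1, m.-1, (Q j k l 0); have BQ := Bgerm_Q j0 jk kl.
  split; split=> //; [exact: Bgerm_X1|exact: Bgerm_ltG Bgerm_X1 BQ _|].
  by apply/leG_M; lia.
- right; exists 2, 3, (W l 0), m, (P j k 0); have BP := Bgerm_P j0 jk.
  have BW := Bgerm_W l0; split; split=> //; first exact: Bgerm_ltG BW BP _.
  exact: Bgerm_leG_lt Bgerm_X1 BW _.
Qed.

Theorem proposition1p9 :
  [/\ Bstar_k 1 = [set b | exists nu, b = M nu],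
      Bstar_k 2 = [set b | exists j nu, 0 < j /\ b = W j nu],
      Bstar_k 3 = [set b | exists j k nu,
        [/\ 0 < j, 0 < k, j <= k & b = P j k nu]],
      Bstar_k 4 =
        [set b | exists j k l nu,
          [&& 0 < j, 0 < k & 0 < l] /\ [/\ j <= k, k <= l & b = Q j k l nu]]
        `|` [set b | exists j mu k nu,
          [/\ 0 < j, 0 < k, j < k & b = Qsharp j mu k nu]]
        `|` [set b | exists j mu nu, 0 < j /\ b = Qflat j mu nu]
    & Bstar_k 5 =
        [set b | exists j k l m nu,
          [&& 0 < j, 0 < k, 0 < l & 0 < m] /\
          [/\ j <= k, k <= l, l <= m & b = R j k l m nu]]
        `|` [set b | exists j k l mu nu,
          [&& 0 < j, 0 < k & 0 < l] /\ (j <= k /\ b = Rsharp j k l mu nu)]].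
Proof.
split; rewrite Bstar_kE //; apply/seteqP; split=> b /=.
- by move=> [g [n [/Bgerm1P -> ->]]]; exists n.
- by move=> [n ->]; exists X1, n; split=> //; exact: Bgerm_X1.
- by move=> [g [n [/Bgerm2P[j [j0 ->]] ->]]]; exists j, n.
- by move=> [j [n [j0 ->]]]; exists (W j 0), n; split=> //; exact: Bgerm_W.
- by move=> [g [n [/Bgerm3P[j [k [j0 k0 jk ->]]] ->]]]; exists j, k, n.
- move=> [j [k [n [j0 k0 jk ->]]]]; exists (P j k 0), n.
  by split=> //; exact: Bgerm_P.
- move=> [g [n [/Bgerm4P[[j [k [l [j0 jk kl ->]]]]|[j [m [k [j0 jk ->]]]]
    |[j [m [j0 ->]]]] ->]]].
  + by left; left; exists j, k, l, n; split=> //; lia.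
  + by left; right; exists j, m, k, n; split=> //; lia.
  + by right; exists j, m, n.
- move=> [[[j [k [l [n [/and3P[j0 k0 l0] [jk kl ->]]]]]]|
    [j [m [k [n [j0 k0 jk ->]]]]]]|[j [m [n [j0 ->]]]]].
  + by exists (Q j k l 0), n; split=> //; exact: Bgerm_Q.
  + exists (Qsharp j m k 0), n; split=> //.
    by apply/Bgerm4P; constructor 2; exists j, m, k.
  + exists (Qflat j m 0), n; split=> //.
    by apply/Bgerm4P; constructor 3; exists j, m.
- move=> [g [n [/Bgerm5P[[j [k [l [m [j0 jk kl lm ->]]]]]|
    [j [k [l [m [j0 l0 jk ->]]]]]] ->]]].
  + by left; exists j, k, l, m, n; split=> //; lia.
  + by right; exists j, k, l, m, n; split=> //; lia.
- move=> [[j [k [l [m [n [/and4P[j0 _ _ _] [jk kl lm ->]]]]]]]|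
    [j [k [l [m [n [/and3P[j0 _ l0] [jk ->]]]]]]]].
  + exists (R j k l m 0), n; split=> //.
    by apply/Bgerm5P; left; exists j, k, l, m.
  + exists (Rsharp j k l m 0), n; split=> //.
    by apply/Bgerm5P; right; exists j, k, l, m.
Qed.
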